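(* Let $k\ge1$ and suppose $\gamma_k(D,A)>0$. Let $s=Be^\star+\xi$ with $e^\star\in\mathcal H$, $\|e^\star\|_{0,\mathrm g}\le k$ and $\|\xi\|_2\le\varepsilon$. If $\widehat e\in\mathcal H$ is any vector with $\|\widehat e\|_{0,\mathrm g}\le k$ and $\|B\widehat e-s\|_2\le\varepsilon$, then $$\|\widehat e-e^\star\|_2\le\frac{2\varepsilon}{\gamma_k(D,A)}.$$ More generally, if $\|\xi\|_2\le\varepsilon_1$ and $\|B\widehat e-s\|_2\le\varepsilon_2$, then $\|\widehat e-e^\star\|_2\le(\varepsilon_1+\varepsilon_2)/\gamma_k(D,A)$. The same bounds hold for the recovered fields: if $y=z^\star+e^\star$ and $\widehat z=y-\widehat e$, then $\widehat z-z^\star=-(\widehat e-e^\star)$, so $\|\widehat z-z^\star\|_2$ satisfies the same inequalities.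
   Context: Let $G=(V,E)$ be a finite directed multigraph with $V=\{1,\dots,n\}$. Each node $i$ carries a finite-dimensional real Hilbert space $\mathcal H_i$; $\mathcal H=\bigoplus_{i=1}^n\mathcal H_i$ (with $\mathcal H\neq\{0\}$), with norm $\|h\|_2^2=\sum_i\|h_i\|^2$. The group sparsity of $h\in\mathcal H$ is $\|h\|_{0,\mathrm g}=|\{i\in V:h_i\ne0\}|$. Each edge $e=(i,j)$ carries a weight $w_e>0$ and a linear map $T_e:\mathcal H_i\to\mathcal H_j$, and $D$ is the linear operator $(Dz)_e=\sqrt{w_e}(z_j-T_ez_i)$, $e=(i,j)\in E$. $A:\mathcal H\to\mathcal K$ is a linear map into a finite-dimensional real Hilbert space. $B$ is the stacked operator $Bh=(Dh,\,Ah)$, so $\|Bh\|_2^2=\|Dh\|_2^2+\|Ah\|_2^2$. The margin is $$\gamma_k(D,A)=\min_{h\ne0,\ \|h\|_{0,\mathrm g}\le2k}\frac{\|Bh\|_2}{\|h\|_2}.$$ Here $z^\star\in\mathcal H$ denotes the unknown true field and $y\in\mathcal H$ the observed corrupted field. *)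

(* Defs.v *)
From HB Require Import structures.
From mathcomp Require Import all_boot all_order all_algebra.
From mathcomp Require Import all_classical all_reals all_analysis.

Set Implicit Arguments.
Unset Strict Implicit.
Unset Printing Implicit Defensive.
Import Order.TTheory GRing.Theory Num.Theory VectorInternalTheory.
Local Open Scope classical_set_scope.
Local Open Scope ring_scope.

(* Finite-dimensional real Hilbert spaces; completeness is automatic. *)
HB.mixin Record hasInner (R : realType) V of GRing.Lmodule R V := {
  inner : {dot V for (@idfun R)}
}.

#[short(type="hilbertType")]
HB.structure Definition Hilbert (R : realType) :=
  {V of Vector R V & hasInner R V}.

Definition hnorm (R : realType) (V : hilbertType R) (x : V) : R :=
  Num.sqrt (inner x x).

Section DirectSum.
Context (R : realType) (I : finType) (H : I -> hilbertType R).

(* {ffun _} carries algebraic structures only for non-dependent functions. *)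
Definition dsum := {dffun forall i, H i}.
HB.instance Definition _ := Choice.on dsum.

Implicit Types x y z : dsum.

Definition dsum_zero : dsum := [ffun i => 0].
Definition dsum_opp x : dsum := [ffun i => - x i].
Definition dsum_add x y : dsum := [ffun i => x i + y i].
Definition dsum_scale (a : R) x : dsum := [ffun i => a *: x i].

Fact dsum_addA : associative dsum_add.
Proof. by move=> x y z; apply/ffunP=> i; rewrite !ffunE addrA. Qed.
Fact dsum_addC : commutative dsum_add.
Proof. by move=> x y; apply/ffunP=> i; rewrite !ffunE addrC. Qed.
Fact dsum_add0 : left_id dsum_zero dsum_add.
Proof. by move=> x; apply/ffunP=> i; rewrite !ffunE add0r. Qed.
Fact dsum_addN : left_inverse dsum_zero dsum_opp dsum_add.
Proof. by move=> x; apply/ffunP=> i; rewrite !ffunE addNr. Qed.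
HB.instance Definition _ :=
  GRing.isZmodule.Build dsum dsum_addA dsum_addC dsum_add0 dsum_addN.

Fact dsum_scaleA a b x : dsum_scale a (dsum_scale b x) = dsum_scale (a * b) x.
Proof. by apply/ffunP=> i; rewrite !ffunE scalerA. Qed.
Fact dsum_scale1 : left_id 1 dsum_scale.
Proof. by move=> x; apply/ffunP=> i; rewrite !ffunE scale1r. Qed.
Fact dsum_scaleDr : right_distributive dsum_scale +%R.
Proof. by move=> a x y; apply/ffunP=> i; rewrite !ffunE scalerDr. Qed.
Fact dsum_scaleDl x : {morph dsum_scale^~ x : a b / a + b}.
Proof. by move=> a b; apply/ffunP=> i; rewrite !ffunE scalerDl. Qed.
HB.instance Definition _ := GRing.Zmodule_isLmodule.Build R dsum
  dsum_scaleA dsum_scale1 dsum_scaleDr dsum_scaleDl.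

Lemma dsumD x y i : (x + y) i = x i + y i.
Proof. by rewrite ffunE. Qed.
Lemma dsumN x i : (- x) i = - x i.
Proof. by rewrite ffunE. Qed.
Lemma dsumZ a x i : (a *: x) i = a *: x i.
Proof. by rewrite ffunE. Qed.
Lemma dsum0 i : (0 : dsum) i = 0.
Proof. by rewrite ffunE. Qed.

Definition dsum_coord := {i : I & 'I_(dim (H i))}.
Fact dsum_vect_iso : Vector.axiom #|{: dsum_coord}| dsum.
Proof.
pose f x : 'rV[R]_#|{: dsum_coord}| :=
  \row_k v2r (x (tag (enum_val k))) 0 (tagged (enum_val k)).
pose g (r : 'rV[R]_#|{: dsum_coord}|) : dsum :=
  [ffun i => r2v (\row_j r 0 (enum_rank (Tagged (fun i => 'I_(dim (H i))) j)))].
exists f.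
  by move=> a x y; apply/rowP=> k; rewrite !mxE dsumD dsumZ linearP !mxE.
exists g => [x|r].
  apply/ffunP=> i; rewrite ffunE -[RHS]v2rK; congr r2v.
  by apply/rowP=> j; rewrite !mxE enum_rankK.
apply/rowP=> k; rewrite mxE ffunE r2vK mxE; congr (r 0 _).
by rewrite -[RHS]enum_valK; congr enum_rank; case: (enum_val k).
Qed.
HB.instance Definition _ := Lmodule_hasFinDim.Build R dsum dsum_vect_iso.

Definition dsum_inner x y : R := \sum_i inner (x i) (y i).

Fact dsum_inner_bilinear : bilinear_for *%R (idfun \; *%R) dsum_inner.
Proof.
split=> u a x y; rewrite /dsum_inner /= mulr_sumr -big_split /=;
  apply: eq_bigr => i _; rewrite dsumD dsumZ.
- by rewrite linearPl.
- by rewrite linearPr.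
Qed.
HB.instance Definition _ := bilinear_isBilinear.Build R dsum dsum R
  *%R (idfun \; *%R) dsum_inner dsum_inner_bilinear.

Fact dsum_inner_sym x y :
  dsum_inner x y = (-1) ^+ false * idfun (dsum_inner y x).
Proof.
rewrite expr0 mul1r; apply: eq_bigr => i _.
by rewrite hermitian_subproof expr0 mul1r.
Qed.
HB.instance Definition _ := isHermitianSesquilinear.Build R dsum
  false idfun dsum_inner dsum_inner_sym.

Fact inner_ge0 (V : hilbertType R) (x : V) : 0 <= inner x x.
Proof.
have [->|x0] := eqVneq x 0; first by rewrite linear0l.
by rewrite ltW// neq0_dnorm_gt0.
Qed.

Fact inner_eq0 (V : hilbertType R) (x : V) : (inner x x == 0) = (x == 0).
Proof.
have [->|x0] := eqVneq x 0; first by rewrite linear0l eqxx.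
by rewrite gt_eqF// neq0_dnorm_gt0.
Qed.

Fact dsum_inner_gt0 x : x != 0 -> 0 < dsum_inner x x.
Proof.
rewrite lt0r sumr_ge0 ?andbT => [|i _]; last exact: inner_ge0.
apply: contraNneq => /eqP; rewrite psumr_eq0 => [/allP x0|i _].
  apply/eqP/ffunP=> i; rewrite dsum0; apply/eqP.
  by have := x0 i (mem_index_enum i); rewrite /= inner_eq0.
exact: inner_ge0.
Qed.
HB.instance Definition _ := isDotProduct.Build R dsum dsum_inner dsum_inner_gt0.
HB.instance Definition _ := hasInner.Build R dsum dsum_inner.

End DirectSum.

Section Pair.
Context (R : realType) (V W : hilbertType R).
Implicit Types x y : (V * W)%type.

Definition pair_inner x y : R := inner x.1 y.1 + inner x.2 y.2.

Fact pair_inner_bilinear : bilinear_for *%R (idfun \; *%R) pair_inner.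
Proof.
split=> u a x y; rewrite /pair_inner /=.
- by rewrite !linearPl mulrDr addrACA.
- by rewrite !linearPr/= mulrDr addrACA.
Qed.
HB.instance Definition _ := bilinear_isBilinear.Build R (V * W)%type (V * W)%type
  R *%R (idfun \; *%R) pair_inner pair_inner_bilinear.

Fact pair_inner_sym x y :
  pair_inner x y = (-1) ^+ false * idfun (pair_inner y x).
Proof.
rewrite expr0 mul1r /pair_inner.
by congr +%R; rewrite hermitian_subproof expr0 mul1r.
Qed.
HB.instance Definition _ := isHermitianSesquilinear.Build R (V * W)%type
  false idfun pair_inner pair_inner_sym.

Fact pair_inner_gt0 x : x != 0 -> 0 < pair_inner x x.
Proof.
rewrite lt0r addr_ge0 ?inner_ge0// andbT; apply: contraNneq => /eqP.
rewrite paddr_eq0 ?inner_ge0// !inner_eq0 => /andP[/eqP x1 /eqP x2].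
by case: x x1 x2 => x1 x2 /= -> ->.
Qed.
HB.instance Definition _ := isDotProduct.Build R (V * W)%type
  pair_inner pair_inner_gt0.
HB.instance Definition _ := hasInner.Build R (V * W)%type pair_inner.

End Pair.

Lemma hnorm_dsum (R : realType) (I : finType) (H : I -> hilbertType R)
  (h : dsum H) : hnorm h ^+ 2 = \sum_i hnorm (h i) ^+ 2.
Proof.
rewrite sqr_sqrtr ?inner_ge0//.
by apply: eq_bigr => i _; rewrite sqr_sqrtr ?inner_ge0.
Qed.

Lemma hnorm_pair (R : realType) (V W : hilbertType R) (x : (V * W)%type) :
  hnorm x ^+ 2 = hnorm x.1 ^+ 2 + hnorm x.2 ^+ 2.
Proof. by rewrite !sqr_sqrtr ?inner_ge0. Qed.

Definition gsparsity (R : realType) (I : finType) (H : I -> hilbertType R)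
  (h : dsum H) : nat := #|[set i | h i != 0]%SET|.

Section EdgeDifference.
Context (R : realType) (V E : finType) (src tgt : E -> V)
  (H : V -> hilbertType R) (w : E -> R)
  (T : forall e, {linear H (src e) -> H (tgt e)}).

Definition edge_diff (z : dsum H) : dsum (fun e => H (tgt e)) :=
  [ffun e => Num.sqrt (w e) *: (z (tgt e) - T e (z (src e)))].

Fact edge_diff_linear : linear edge_diff.
Proof.
move=> a x y; apply/ffunP=> e; rewrite dsumD dsumZ !ffunE linearP.
by rewrite opprD addrACA -scalerBr scalerDr !scalerA [a * _]mulrC.
Qed.
HB.instance Definition _ := GRing.isLinear.Build R (dsum H)
  (dsum (fun e => H (tgt e))) _ edge_diff edge_diff_linear.

End EdgeDifference.

Section Stack.
Context (R : realType) (V W W' : hilbertType R)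
  (D : {linear V -> W}) (A : {linear V -> W'}).

Definition stack (h : V) : (W * W')%type := (D h, A h).

Fact stack_linear : linear stack.
Proof. by move=> a x y; rewrite /stack !linearP. Qed.
HB.instance Definition _ :=
  GRing.isLinear.Build R V (W * W')%type _ stack stack_linear.

End Stack.

Section Margin.
Context (R : realType) (I : finType) (H : I -> hilbertType R)
  (W W' : hilbertType R) (D : {linear dsum H -> W}) (A : {linear dsum H -> W'}).

Definition margin_ratios (k : nat) : set R :=
  [set hnorm (stack D A h) / hnorm h
     | h in [set h : dsum H | h != 0 /\ (gsparsity h <= 2 * k)%N]].

(* The least element of [margin_ratios k]; it exists as soon as the direct sum
   is nonzero and k > 0, see [margin_min] below. *)
Definition margin (k : nat) : R :=
  xget 0 (margin_ratios k `&` lbound (margin_ratios k)).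

End Margin.

Section MarginMin.
Import numFieldNormedType.Exports.
Context (R : realType).

Lemma hnormZ (V : hilbertType R) (a : R) (x : V) :
  hnorm (a *: x) = `|a| * hnorm x.
Proof.
rewrite /hnorm linearZl_LR linearZr_LR/= mulrA -expr2.
by rewrite sqrtrM ?sqr_ge0// sqrtr_sqr.
Qed.

Lemma hnorm_eq0 (V : hilbertType R) (x : V) : (hnorm x == 0) = (x == 0).
Proof. by rewrite sqrtr_eq0 le_eqVlt ltNge inner_ge0 orbF inner_eq0. Qed.

Lemma continuous_quadratic (X : topologicalType) n (c : 'I_n -> X -> R)
    (M : 'I_n -> 'I_n -> R) : (forall i, continuous (c i)) ->
  continuous (fun r => \sum_i \sum_j c i r * (c j r * M i j)).
Proof.
move=> cc r; apply: cvg_big => [|i _]; first exact: add_continuous.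
apply: cvg_big => [|j _]; first exact: add_continuous.
apply: cvgM; first exact: cc.
by apply: cvgM; [exact: cc|exact: cvg_cst].
Qed.

Lemma continuous_inner_linear n (W : hilbertType R)
  (L : {linear 'rV[R]_n -> W}) : continuous (fun r => inner (L r) (L r)).
Proof.
have Le r : L r = \sum_i r 0 i *: L (delta_mx 0 i).
  rewrite {1}[r]row_sum_delta linear_sum; apply: eq_bigr => i _.
  by rewrite linearZ.
rewrite (_ : (fun r => inner (L r) (L r)) = (fun r : 'rV[R]_n =>
    \sum_i \sum_j r 0 i * (r 0 j *
      inner (L (delta_mx 0 i)) (L (delta_mx 0 j))))); last first.
  apply/funext => r; rewrite Le linear_sumlz; apply: eq_bigr => i _.
  rewrite linear_sumr; apply: eq_bigr => j _.
  by rewrite linearZl_LR linearZr_LR.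
apply: (@continuous_quadratic 'rV[R]_n n (fun i r => r 0 i)) => i.
exact: coord_continuous.
Qed.

Lemma continuous_hnorm_linear n (W : hilbertType R)
  (L : {linear 'rV[R]_n -> W}) : continuous (fun r => hnorm (L r)).
Proof.
move=> r; apply: (@continuous_comp _ _ _ (fun r => inner (L r) (L r)) Num.sqrt).
  exact: continuous_inner_linear.
exact: sqrt_continuous.
Qed.

Context (I : finType) (H : I -> hilbertType R)
  (W W' : hilbertType R) (D : {linear dsum H -> W}) (A : {linear dsum H -> W'}).

Definition dsum_proj i (x : dsum H) : H i := x i.
Fact dsum_proj_linear i : linear (dsum_proj i).
Proof. by move=> a x y; rewrite /dsum_proj dsumD dsumZ. Qed.
HB.instance Definition _ i := GRing.isLinear.Build R (dsum H) (H i) _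
  (dsum_proj i) (dsum_proj_linear i).

Lemma gsparsityZ (a : R) (h : dsum H) :
  (gsparsity (a *: h) <= gsparsity h)%N.
Proof.
apply: subset_leq_card; apply/fintype.subsetP => i; rewrite !inE dsumZ.
by apply: contraNneq => ->; rewrite scaler0.
Qed.

Lemma closed_sparse m :
  closed [set r : 'rV[R]_(dim (dsum H)) | (gsparsity (r2v r) <= m)%N].
Proof.
rewrite (_ : mkset _ = \bigcup_(J in [set J : {set I} | (#|J| <= m)%N])
   \bigcap_(i in [set i | i \notin J]) [set r | hnorm ((r2v r : dsum H) i) = 0]); last first.
  apply/seteqP; split => r /=.
    move=> rm; exists [set i | (r2v r : dsum H) i != 0]%SET => //= i /=.
    by rewrite inE negbK => /eqP ->; apply/eqP; rewrite hnorm_eq0.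
  move=> [J /= Jm rJ]; apply: leq_trans Jm; apply: subset_leq_card.
  apply/fintype.subsetP => i; rewrite inE; apply: contraNT => /rJ /= /eqP.
  by rewrite hnorm_eq0.
apply: closed_bigcup => [|J _]; first exact: finite_finset.
apply: closed_bigI => i _.
apply: (@preimage_closed _ _ (fun r : 'rV[R]_(dim (dsum H)) => hnorm ((r2v r : dsum H) i))
  [set x | x = 0]); last exact: closed_eq.
by move=> r _; exact: (@continuous_hnorm_linear _ _ (dsum_proj i \o r2v)).
Qed.

Lemma margin_min k : (exists h : dsum H, h != 0) -> (0 < k)%N ->
  margin_ratios D A k (margin D A k) /\
  lbound (margin_ratios D A k) (margin D A k).
Proof.
move=> [h0 h0_neq0] k0; rewrite /margin.
suff [g Sg] : exists g, (margin_ratios D A k `&` lbound (margin_ratios D A k)) g.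
  by case: xgetP => [? -> //|] /(_ g).
pose f (r : 'rV[R]_(dim (dsum H))) :=
  hnorm (stack D A (r2v r)) / hnorm (r2v r).
pose C := [set r : 'rV[R]_(dim (dsum H)) | `|r| = 1] `&`
  [set r | (gsparsity (r2v r) <= 2 * k)%N].
have r2v_neq0 (r : 'rV[R]_(dim (dsum H))) : (r2v r != 0) = (r != 0).
  by rewrite (can2_eq r2vK v2rK) linear0.
have f_scale (a : R) r : a != 0 -> f (a *: r) = f r.
  move=> a0; rewrite /f !linearZ !hnormZ invfM mulrACA.
  by rewrite divff ?mul1r// normr_eq0.
have C_scale r : r != 0 -> (gsparsity (r2v r) <= 2 * k)%N -> C (`|r|^-1 *: r).
  move=> r0 rk; split=> /=.
    by rewrite normrZ ger0_norm ?invr_ge0// mulVf ?normr_eq0.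
  by rewrite linearZ (leq_trans (gsparsityZ _ _)).
have C_neq0 r : C r -> r2v r != 0.
  by rewrite r2v_neq0 -normr_eq0 => -[/= -> _]; exact: oner_neq0.
have [i h0i] : exists i, h0 i != 0.
  apply/existsP; apply: contraNT h0_neq0 => /existsPn h0E; apply/eqP/ffunP=> i.
  by rewrite dsum0; apply/eqP; have := h0E i; rewrite negbK.
pose h1 : dsum H := [ffun j => if j == i then h0 j else 0].
have C0 : C !=set0.
  exists (`|v2r h1|^-1 *: v2r h1); apply: C_scale.
    rewrite -r2v_neq0 v2rK; apply: contraNneq h0i => h10.
    by have := ffunE (fun j => if j == i then h0 j else 0) i;
       rewrite -/h1 h10 dsum0 eqxx => <-.
  rewrite v2rK; apply: (@leq_trans #|[set i]%SET|).
    apply: subset_leq_card; apply/fintype.subsetP => j; rewrite !inE ffunE.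
    by case: ifP => //; rewrite eqxx.
  by rewrite cards1 muln_gt0.
have cC : compact C.
  apply: bounded_closed_compact.
    exists 1; split=> // x x1 r [/= -> _]; exact: ltW.
  apply: closedI; last exact: closed_sparse.
  apply: (@preimage_closed _ _ (fun r : 'rV[R]_(dim (dsum H)) => `|r|) [set x | x = 1]).
    by move=> r _; exact: norm_continuous.
  exact: closed_eq.
have cf : {within C, continuous f}.
  apply: continuous_in_subspaceT => r /set_mem Cr.
  have c1 := @continuous_hnorm_linear _ _ (stack D A \o r2v) r.
  have c2 := @continuous_hnorm_linear _ _ (@r2v R (dsum H)) r.
  apply: cvgM c1 (cvgV _ c2); by rewrite hnorm_eq0 C_neq0.
have [c /set_mem Cc cmin] := EVT_min_rV C0 cC cf.
exists (f c); split.
  by exists (r2v c) => //=; split; [exact: C_neq0|case: Cc].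
move=> _ [h [h_neq0 hk] <-]; have vh0 : v2r h != 0 by rewrite -r2v_neq0 v2rK.
have -> : hnorm (stack D A h) / hnorm h = f (v2r h) by rewrite /f v2rK.
rewrite -(f_scale `|v2r h|^-1 (v2r h)) ?invr_eq0 ?normr_eq0//.
by apply: cmin; apply/mem_set/C_scale; rewrite ?v2rK.
Qed.

End MarginMin.

(* Main.v *)
(* The difference of two k-sparse fields is 2k-sparse, so the margin bounds it
   by its image under B, and [B (ehat - estar) = xi + (B ehat - s)]. *)

Require Import Defs.
From HB Require Import structures.
From mathcomp Require Import all_boot all_order all_algebra.
From mathcomp Require Import all_classical all_reals all_analysis.
From mathcomp Require Import lra.

Set Implicit Arguments.
Unset Strict Implicit.
Unset Printing Implicit Defensive.
Import Order.TTheory GRing.Theory Num.Theory.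
Local Open Scope ring_scope.

(** The error [ehat - estar] lives on the union of two supports of size at most k, hence it is one
    of the vectors over which the margin is minimised, and gamma times its norm is at most the norm
    of its image under B ([gsparsityB], [margin_ler]). That image is the noise plus the residual of
    [ehat], so the triangle inequality bounds it by the sum of the two error levels; dividing by
    gamma > 0 gives the estimate ([sparse_recovery]). The triangle inequality comes from
    Cauchy-Schwarz for [inner]. *)

Lemma innerC (R : realType) (V : hilbertType R) (x y : V) :
  inner x y = inner y x.
Proof. by rewrite hermitian_subproof expr0 mul1r. Qed.

Lemma hnormN (R : realType) (V : hilbertType R) (x : V) : hnorm (- x) = hnorm x.
Proof. by rewrite -scaleN1r hnormZ normrN1 mul1r. Qed.

Lemma hnorm_sqr (R : realType) (V : hilbertType R) (x : V) :
  hnorm x ^+ 2 = inner x x.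
Proof. by rewrite sqr_sqrtr ?inner_ge0. Qed.

Lemma hnorm_ge0 (R : realType) (V : hilbertType R) (x : V) : 0 <= hnorm x.
Proof. exact: sqrtr_ge0. Qed.

(** Cauchy-Schwarz in its one-sided form, which is all that the triangle inequality needs. Zero
    vectors are set aside because the argument divides by the product of the norms. *)
Lemma inner_le_hnorm (R : realType) (V : hilbertType R) (x y : V) :
  inner x y <= hnorm x * hnorm y.
Proof.
have [->|y0] := eqVneq y 0; first by rewrite linear0r mulr_ge0 ?hnorm_ge0.
have [->|x0] := eqVneq x 0; first by rewrite linear0l mulr_ge0 ?hnorm_ge0.
have x_gt0 : 0 < hnorm x by rewrite lt0r hnorm_eq0 x0 hnorm_ge0.
have y_gt0 : 0 < hnorm y by rewrite lt0r hnorm_eq0 y0 hnorm_ge0.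
(* Expand the squared norm of [|y| x - |x| y]. *)
have := inner_ge0 (hnorm y *: x - hnorm x *: y).
rewrite linearBl linearBr /= linearBr /= !linearZl_LR !linearZr_LR /=.
rewrite (innerC y x) -!hnorm_sqr /GRing.scale /= => h.
(* The expansion equals 2|x||y| (|x||y| - <x,y>), so the goal is multiplied by |x||y| > 0 to match
   it. *)
rewrite -subr_ge0 -(pmulr_rge0 _ (mulr_gt0 x_gt0 y_gt0)).
lra.
Qed.

Lemma ler_hnormD (R : realType) (V : hilbertType R) (x y : V) :
  hnorm (x + y) <= hnorm x + hnorm y.
Proof.
(* Both sides are nonnegative, so squares are compared; they differ only in the cross term, which
   Cauchy-Schwarz controls. *)
rewrite -(@ler_pXn2r _ 2) ?nnegrE ?addr_ge0 ?hnorm_ge0//.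
rewrite hnorm_sqr linearDl linearDr /= linearDr /= (innerC y x) -!hnorm_sqr.
have := inner_le_hnorm x y; lra.
Qed.

(** The support of a difference is contained in the union of the supports. *)
Lemma gsparsityB (R : realType) (I : finType) (H : I -> hilbertType R)
  (x y : dsum H) : (gsparsity (x - y)%R <= gsparsity x + gsparsity y)%N.
Proof.
apply: leq_trans (leq_card_setU _ _); apply: subset_leq_card.
apply/fintype.subsetP => i; rewrite !inE dsumD dsumN -negb_and.
by apply: contraNN => /andP[/eqP -> /eqP ->]; rewrite subrr.
Qed.

(** The minimality of the margin with the denominator cleared, a form that also covers h = 0, where
    the ratio is not considered. *)
Lemma margin_ler (R : realType) (I : finType) (H : I -> hilbertType R)
    (W W' : hilbertType R) (D : {linear dsum H -> W})
    (A : {linear dsum H -> W'}) (k : nat) (h : dsum H) :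
  (0 < k)%N -> (gsparsity h <= 2 * k)%N ->
  margin D A k * hnorm h <= hnorm (stack D A h).
Proof.
move=> k_gt0 hk.
have [->|h0] := eqVneq h 0.
  have -> : hnorm (0 : dsum H) = 0 by apply/eqP; rewrite hnorm_eq0.
  by rewrite mulr0 hnorm_ge0.
have h_gt0 : 0 < hnorm h by rewrite lt0r hnorm_eq0 h0 hnorm_ge0.
rewrite -ler_pdivlMr //.
(* The vector h itself witnesses that the direct sum is nonzero, so the minimum exists and bounds
   the ratio at h from below. *)
have [_] := margin_min D A (ex_intro _ h h0) k_gt0.
by apply; exists h.
Qed.

Lemma sparse_recovery (R : realType) (I : finType) (H : I -> hilbertType R)
    (W W' : hilbertType R) (D : {linear dsum H -> W})
    (A : {linear dsum H -> W'}) (k : nat) (x y : dsum H) (xi : (W * W')%type)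
    (eps1 eps2 : R) :
  (0 < k)%N -> 0 < margin D A k ->
  (gsparsity x <= k)%N -> (gsparsity y <= k)%N ->
  hnorm xi <= eps1 ->
  hnorm (stack D A y - (stack D A x + xi)) <= eps2 ->
  hnorm (y - x) <= (eps1 + eps2) / margin D A k.
Proof.
move=> k_gt0 m_gt0 xk yk xi1 res2; rewrite ler_pdivlMr // mulrC.
apply: le_trans (margin_ler D A k_gt0 _) _.
  by apply: leq_trans (gsparsityB _ _) _; rewrite mul2n -addnn leq_add.
(* By linearity the image of the error splits into the noise [xi] and the residual of y, which are
   bounded separately. *)
have -> : stack D A (y - x) =
    xi + (stack D A y - (stack D A x + xi)).
  by rewrite linearB [RHS]addrC opprD !addrA subrK.
exact: le_trans (ler_hnormD _ _) (lerD xi1 res2).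
Qed.

Theorem theorem4 (R : realType) (n : nat) (E : finType) (src tgt : E -> 'I_n)
    (H : 'I_n -> hilbertType R) (K : hilbertType R)
    (w : E -> R) (T : forall e : E, {linear H (src e) -> H (tgt e)})
    (A : {linear dsum H -> K}) (k : nat)
    (H_neq0 : exists h : dsum H, h != 0)
    (w_gt0 : forall e : E, 0 < w e)
    (k_ge1 : (1 <= k)%N)
    (margin_gt0 : 0 < margin (edge_diff w T) A k)
    (estar ehat : dsum H) (xi s : (dsum (fun e => H (tgt e)) * K)%type)
    (s_def : s = stack (edge_diff w T) A estar + xi)
    (estar_sparse : (gsparsity estar <= k)%N)
    (ehat_sparse : (gsparsity ehat <= k)%N) :
  let B := stack (edge_diff w T) A in
  let gamma := margin (edge_diff w T) A k in
  [/\ forall eps : R,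
        hnorm xi <= eps -> hnorm (B ehat - s) <= eps ->
        hnorm (ehat - estar) <= 2 * eps / gamma,
      forall eps1 eps2 : R,
        hnorm xi <= eps1 -> hnorm (B ehat - s) <= eps2 ->
        hnorm (ehat - estar) <= (eps1 + eps2) / gamma
    & forall zstar y zhat : dsum H,
        y = zstar + estar -> zhat = y - ehat ->
        [/\ zhat - zstar = - (ehat - estar),
            forall eps : R,
              hnorm xi <= eps -> hnorm (B ehat - s) <= eps ->
              hnorm (zhat - zstar) <= 2 * eps / gamma
          & forall eps1 eps2 : R,
              hnorm xi <= eps1 -> hnorm (B ehat - s) <= eps2 ->
              hnorm (zhat - zstar) <= (eps1 + eps2) / gamma]].
Proof.
move=> B gamma.
have bound eps1 eps2 : hnorm xi <= eps1 -> hnorm (B ehat - s) <= eps2 ->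
    hnorm (ehat - estar) <= (eps1 + eps2) / gamma.
  by rewrite s_def; exact: sparse_recovery.
have bound2 eps : hnorm xi <= eps -> hnorm (B ehat - s) <= eps ->
    hnorm (ehat - estar) <= 2 * eps / gamma.
  by rewrite mulr_natl mulr2n; exact: bound.
split=> // zstar y zhat -> ->.
(* The true field cancels, so the field error is the negated corruption error and has the same
   norm. *)
have -> : zstar + estar - ehat - zstar = - (ehat - estar).
  by rewrite opprB -[zstar + _ - _]addrA [LHS]addrC addKr.
by rewrite hnormN.
Qed.
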